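(* Consider the least-squares problem $\min_{\mathbf{x}} \|\mathbf{A}\mathbf{x} - \mathbf{b}\|^2$, where $\mathbf{A} \in \mathbb{R}^{m \times n}$ is a nonzero, not necessarily full-rank matrix and $\mathbf{b} \in \mathbb{R}^m$. Let $\mathbf{e} = \mathbf{A}\mathbf{x}_{\mathbf{e}} - \mathbf{b}$ for some $\mathbf{x}_{\mathbf{e}}\in\mathbb{R}^n$, and let $T=\{\tau_1, \dots, \tau_d\}$ be a $(d, \alpha, \beta, r, R)$ row covering of $\mathbf{A}$ (not necessarily a partition of the rows) with $\alpha>0$. Let $\mathbf{x}_j$ denote the $j$th iterate produced by the block randomized Kaczmarz method on the system defined by $\mathbf{A}$ and $\mathbf{b}$ with blocks $T$ and initial iterate $\mathbf{x}_0\in\mathbb{R}^n$, and let $$\mathbf{x}^\ast := (\mathbf{I} - \mathbf{A}^\dagger \mathbf{A})\mathbf{x}_0 + \mathbf{A}^{\dagger}(\mathbf{b} + \mathbf{e}) = (\mathbf{I} - \mathbf{A}^\dagger \mathbf{A})\mathbf{x}_0 + \mathbf{A}^{\dagger}\mathbf{A}\mathbf{x}_{\mathbf{e}}.$$ Then for all $j\ge 0$, $$\mathbb{E}\left(\|\mathbf{x}_{j} - \mathbf{x}^\ast\|^2\right) \leq \left(1 - \frac{r\,\sigma_{\min +}^2(\mathbf{A})}{\beta d}\right)^{j} \|\mathbf{x}_0 - \mathbf{x}^\ast\|^2 + \frac{\beta R}{\alpha\, r\, \sigma_{\min +}^2(\mathbf{A})} \|\mathbf{e}\|^2,$$ where $\sigma_{\min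 +}(\mathbf{A})$ is the smallest nonzero singular value of $\mathbf{A}$.
   Context: $\|\cdot\|$ is the Euclidean norm, $[m]=\{1,\dots,m\}$, $\mathbf{A}^\dagger$ is the Moore–Penrose pseudoinverse, and $\mathbf{A}_\tau$, $\mathbf{b}_\tau$ denote the restriction to the rows (entries) indexed by $\tau\subset[m]$. Row covering: a $(d,\alpha,\beta,r,R)$ row covering of $\mathbf{A}$ is a collection $T=\{\tau_1,\dots,\tau_d\}$ of subsets of $[m]$ such that every $i\in[m]$ lies in some $\tau_l$, and $\alpha \le \lambda_{\min+}(\mathbf{A}_\tau\mathbf{A}_\tau^\top)$ and $\lambda_{\max}(\mathbf{A}_\tau\mathbf{A}_\tau^\top)\le\beta$ for each $\tau\in T$, where $\lambda_{\min+}$ and $\lambda_{\max}$ denote the smallest nonzero and the largest eigenvalue, and $r=\min_{i\in[m]}|\{\tau_l\in T: i\in\tau_l\}|$, $R=\max_{i\in[m]}|\{\tau_l\in T: i\in\tau_l\}|$. Block randomized Kaczmarz method: at iteration $k\ge1$ choose $\tau$ uniformly at random from $T$ (independently of previous choices) and set $\mathbf{x}_k = \mathbf{x}_{k-1} + \mathbf{A}_{\tau}^\dagger(\mathbf{b}_\tau - \mathbf{A}_\tau\mathbf{x}_{k-1})$. *)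

(* Defs.v *)
From HB Require Import structures.
From mathcomp Require Import all_boot all_order all_algebra finmap.
From mathcomp Require Import all_classical all_reals all_analysis.

Set Implicit Arguments.
Unset Strict Implicit.
Unset Printing Implicit Defensive.

Import Order.TTheory GRing.Theory Num.Theory.

Local Open Scope classical_set_scope.
Local Open Scope ring_scope.

(* The library norm [`|v|] on matrices is the sup norm. *)
Definition norm2 (K : realType) (n : nat) (v : 'cV[K]_n) : K :=
  Num.sqrt (\sum_(i < n) v i 0 ^+ 2).

Definition moore_penrose (K : realType) (m n : nat)
    (A : 'M[K]_(m, n)) (X : 'M[K]_(n, m)) : Prop :=
  [/\ A *m X *m A = A, X *m A *m X = X,
      (A *m X)^T = A *m X & (X *m A)^T = X *m A].

(* The Moore-Penrose pseudoinverse; the library's [pinvmx] satisfies only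
   some of the Penrose equations. The default value 0 is never used, since
   every real matrix has exactly one Moore-Penrose pseudoinverse. *)
Definition mpinv (K : realType) (m n : nat) (A : 'M[K]_(m, n)) :
    'M[K]_(n, m) :=
  xget 0 [set X | moore_penrose A X].

Definition rows (K : realType) (m n : nat) (t : {set 'I_m})
    (A : 'M[K]_(m, n)) : 'M[K]_(#|t|, n) :=
  rowsub (fun i : 'I_#|t| => enum_val i) A.

(* Extended-real valued, so that a matrix without nonzero eigenvalue has
   smallest nonzero eigenvalue +oo (the infimum of the empty set), and a
   matrix of size 0 has largest eigenvalue -oo. *)
Definition lambda_min_nz (K : realType) (n : nat) (M : 'M[K]_n) : \bar K :=
  ereal_inf [set a%:E | a in [set a : K | eigenvalue M a /\ a != 0]].

Definition lambda_max (K : realType) (n : nat) (M : 'M[K]_n) : \bar K :=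
  ereal_sup [set a%:E | a in [set a : K | eigenvalue M a]].

Definition singular_value (K : realType) (m n : nat) (A : 'M[K]_(m, n))
    (s : K) : Prop :=
  0 <= s /\ eigenvalue (A^T *m A) (s ^+ 2).

(* The infimum is over a finite set, nonempty when [A != 0]. *)
Definition sigma_min_nz (K : realType) (m n : nat) (A : 'M[K]_(m, n)) : K :=
  inf [set s : K | singular_value A s /\ s != 0].

Definition multiplicity (m d : nat) (tau : 'I_d -> {set 'I_m}) (i : 'I_m) :
    nat :=
  #|[pred l : 'I_d | i \in tau l]|.

(* The blocks are an indexed family tau_1, ..., tau_d; repetitions are allowed
   and counted. All multiplicities are at most d, so starting the minimum
   from d does not change it when m > 0. *)
Definition row_covering (K : realType) (m n : nat) (A : 'M[K]_(m, n))
    (d : nat) (alpha beta : K) (r R : nat) (tau : 'I_d -> {set 'I_m}) :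
    Prop :=
  [/\ forall i : 'I_m, exists l : 'I_d, i \in tau l,
      forall l : 'I_d,
        (alpha%:E <= lambda_min_nz (rows (tau l) A *m (rows (tau l) A)^T))%E,
      forall l : 'I_d,
        (lambda_max (rows (tau l) A *m (rows (tau l) A)^T) <= beta%:E)%E,
      r = \big[minn/d]_(i < m) multiplicity tau i
    & R = \max_(i < m) multiplicity tau i].

(* [c k] is the index of the block used to pass from [x_k] to [x_(k+1)]. *)
Fixpoint block_kaczmarz (K : realType) (m n d : nat) (A : 'M[K]_(m, n))
    (b : 'cV[K]_m) (tau : 'I_d -> {set 'I_m}) (x0 : 'cV[K]_n)
    (c : nat -> 'I_d) (k : nat) : 'cV[K]_n :=
  if k is k'.+1 then
    let x := block_kaczmarz A b tau x0 c k' in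
    let t := tau (c k') in
    x + mpinv (rows t A) *m (rows t b - rows t A *m x)
  else x0.

(* Mutually independent random variables, uniform on ['I_d], which carries
   the discrete sigma-algebra. *)
Definition iid_uniform (K : realType) (disp : measure_display)
    (Omega : measurableType disp) (P : probability Omega K) (d : nat)
    (c : nat -> Omega -> 'I_d) : Prop :=
  [/\ forall k (B : set 'I_d), measurable (c k @^-1` B),
      forall k (l : 'I_d), P (c k @^-1` [set l]) = (d%:R^-1)%:E
    & forall (J : {fset nat}) (B : nat -> set 'I_d),
        P (\bigcap_(k in [set` J]) (c k @^-1` B k)) =
        (\prod_(k <- J) P (c k @^-1` B k))%E].

(* Main.v *)
Require Import Defs.
From HB Require Import structures.
From mathcomp Require Import all_boot all_order all_algebra finmap.
From mathcomp Require Import complex polyrcf.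
From mathcomp Require Import all_classical all_reals all_analysis.
From mathcomp Require Import ring.

Set Implicit Arguments.
Unset Strict Implicit.
Unset Printing Implicit Defensive.

Import Order.TTheory GRing.Theory Num.Theory.

Local Open Scope ring_scope.

(** The error v = x - xs lives in the range of A^T throughout the iteration.
    Since A xs = b + e, one step with block B = A_tau replaces v by
    (v - B^+ B v) - B^+ e_tau, where B^+ B is the orthogonal projection onto
    the range of B^T and B^+ e_tau lies in that range.  Pythagoras
    ([sqnorm_step]) then gives the new squared error
      |v|^2 - |B^+ B v|^2 + |B^+ e_tau|^2.
    The spectral bounds on B B^T control the two corrections:
    |B v|^2 <= beta |B^+ B v|^2 ([sqnorm_mul_le_proj]) and
    alpha |B^+ e_tau|^2 <= |e_tau|^2 ([sqnorm_mpinv_le]).  Averaging over the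
    blocks, row i occurs between r and R times, so the blocks capture at least
    r |A v|^2 in total and the noise contributes at most R |e|^2; and
    |A v|^2 >= sigma^2 |v|^2 because v is in the range of A^T
    ([sigma_min_nz_bound]).  Hence one averaged step is an affine contraction
    ([mean_kaczmarz_step_le]) of ratio rho = 1 - r sigma^2 / (beta d), whose
    fixed point is beta R / (alpha r sigma^2) |e|^2, and iterating it yields
    the bound ([iter_mean_step_le]).

    Both spectral facts come from diagonalising a real symmetric matrix
    ([spectral_weights]).  On the probabilistic side, the j-th iterate depends
    only on the first j choices, so by independence its expectation is the
    j-fold iterate of the averaging operator [mean_step]
    ([expectation_trajectory]). *)

(** * Squared Euclidean norm and spectral decomposition *)

Definition sqnorm (K : realType) (n : nat) (v : 'cV[K]_n) : K :=
  \sum_(i < n) v i 0 ^+ 2.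

Lemma norm2_sqr (K : realType) n (v : 'cV[K]_n) : norm2 v ^+ 2 = sqnorm v.
Proof. by rewrite sqr_sqrtr// sumr_ge0// => i _; exact: sqr_ge0. Qed.

Lemma sqnorm_ge0 (K : realType) n (v : 'cV[K]_n) : 0 <= sqnorm v.
Proof. by rewrite sumr_ge0// => i _; exact: sqr_ge0. Qed.

Lemma sqnorm_gt0 (K : realType) n (v : 'cV[K]_n) : (0 < sqnorm v) = (v != 0).
Proof.
rewrite lt_def sqnorm_ge0 andbT; congr (~~ _); apply/eqP/eqP => [s0|->].
  apply/colP => i; rewrite mxE; apply/eqP; rewrite -sqrf_eq0; apply/eqP.
  by apply: (psumr_eq0P _ s0) => // k _; exact: sqr_ge0.
by rewrite /sqnorm big1// => i _; rewrite mxE expr0n.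
Qed.

Lemma sqnormE (K : realType) n (v : 'cV[K]_n) : sqnorm v = (v^T *m v) 0 0.
Proof. by rewrite mxE; apply: eq_bigr => i _; rewrite !mxE expr2. Qed.

Section SpectralWeights.
Local Open Scope sesquilinear_scope.

(** In an orthonormal eigenbasis of M, the weight w i is the squared modulus
    of the i-th coordinate of u and l i is the i-th eigenvalue.  Comparing the
    two quadratic forms thus reduces to comparing l i with l i ^ 2.  The basis
    is obtained over the complex numbers; eigenvalues and weights are real, so
    no complex quantity remains in the statement. *)
Lemma spectral_weights (K : realType) n (M : 'M[K]_n) (u : 'cV[K]_n) :
  M^T = M ->
  exists l w : 'I_n -> K,
    [/\ forall i, eigenvalue M (l i), forall i, 0 <= w i,
        (u^T *m M *m u) 0 0 = \sum_i w i * l i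
      & sqnorm (M *m u) = \sum_i w i * l i ^+ 2].
Proof.
move=> sM; pose f : {rmorphism K -> K[i]} := real_complex K.
pose Mc := map_mx f M.
have freal (z : K) : f z \is Num.real by rewrite complex_real.
have Mreal : Mc \is a realmx by apply/mxOverP => i j; rewrite mxE.
have Mherm : Mc \is hermsymmx.
  apply: realsym_hermsym => //; apply/is_hermitianmxP.
  rewrite expr0 scale1r map_mx_id // /Mc.
  by rewrite map_trmx sM.
have Mnorm := hermitian_normalmx Mherm.
have /mxOverP Dreal := hermitian_spectral_diag_real Mherm.
set P := spectralmx Mc; set D := spectral_diag Mc.
have Pu : P \is unitarymx by exact: spectral_unitarymx.
have MP : Mc = P^t* *m diag_mx D *m P.
  by rewrite -invmx_unitary//; exact/orthomx_spectralP.
have PP : P *m P^t* = 1%:M by exact/unitarymxP.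
(* A Hermitian matrix has real spectrum, so each eigenvalue comes from K. *)
have lE i : D 0 i = f (complex.Re (D 0 i)).
  by rewrite /f /= RRe_real.
pose y := P *m map_mx f u.
have yT : y^t* = map_mx f u^T *m P^t*.
  rewrite /y trmx_mul map_mxM; congr (_ *m _).
  by apply/matrixP => i j; rewrite !mxE; exact/CrealP.
have wE i : (y i 0)^* * y i 0 = f (complex.Re `|y i 0| ^+ 2).
  rewrite rmorphXn.
  have -> : f (complex.Re `|y i 0|) = `|y i 0|.
    by rewrite -[RHS](RRe_real (normr_real _)).
  by rewrite normCKC.
exists (fun i => complex.Re (D 0 i)),
  (fun i => complex.Re `|y i 0| ^+ 2); split.
- move=> i; rewrite -(eigenvalue_map f) -lE.
  apply/eigenvalueP; exists (row i P).
    rewrite -row_mul -[map_mx _ _]/Mc MP !mulmxA PP mul1mx.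
    by rewrite row_mul row_diag_mx -scalemxAl -rowE.
  apply/eqP => r0.
  have := congr1 (row i) PP; rewrite row_mul r0 mul0mx row1 => /rowP/(_ i)/eqP.
  by rewrite !mxE !eqxx eq_sym oner_eq0.
- by move=> i; rewrite sqr_ge0.
- apply: (fmorph_inj f).
  have -> : f ((u^T *m M *m u) 0 0) = (y^t* *m diag_mx D *m y) 0 0.
    have <- : map_mx f (u^T *m M *m u) = y^t* *m diag_mx D *m y.
      by rewrite yT !map_mxM -[map_mx f M]/Mc MP /y !mulmxA.
    by rewrite [RHS]mxE.
  rewrite rmorph_sum mxE; apply: eq_bigr => i _.
  rewrite rmorphM /= -(wE i) -(lE i).
  by rewrite mul_mx_diag !mxE mulrAC.
- apply: (fmorph_inj f).
  have -> : f (sqnorm (M *m u)) = (y^t* *m diag_mx D *m diag_mx D *m y) 0 0.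
    have <- : map_mx f ((M *m u)^T *m (M *m u)) =
        y^t* *m diag_mx D *m diag_mx D *m y.
      have uM : map_mx f (M *m u)^T = y^t* *m diag_mx D *m P.
        by rewrite trmx_mul sM map_mxM -[map_mx f M]/Mc MP yT !mulmxA.
      have Mu : map_mx f (M *m u) = P^t* *m (diag_mx D *m y).
        by rewrite map_mxM -[map_mx f M]/Mc MP !mulmxA.
      by rewrite map_mxM uM Mu mulmxA (mulmxtVK _ Pu) mulmxA.
    by rewrite [RHS]mxE sqnormE.
  rewrite rmorph_sum mxE; apply: eq_bigr => i _.
  rewrite rmorphM /= -(wE i) rmorphXn -(lE i).
  by rewrite !mul_mx_diag !mxE; ring.
Qed.

End SpectralWeights.

Lemma sqnormN (K : realType) n (v : 'cV[K]_n) : sqnorm (- v) = sqnorm v.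
Proof. by apply: eq_bigr => i _; rewrite mxE sqrrN. Qed.

Lemma sqnorm_trmul (K : realType) p n (B : 'M[K]_(p, n)) (g : 'cV[K]_p) :
  sqnorm (B^T *m g) = (g^T *m (B *m B^T) *m g) 0 0.
Proof. by rewrite sqnormE trmx_mul trmxK !mulmxA. Qed.

Lemma eigenvalue_gram_ge0 (K : realType) p n (B : 'M[K]_(p, n)) (a : K) :
  eigenvalue (B *m B^T) a -> 0 <= a.
Proof.
move=> /eigenvalueP[v va v0].
have v_gt0 : 0 < sqnorm v^T by rewrite sqnorm_gt0 trmx_eq0.
rewrite -(pmulr_lge0 _ v_gt0).
have <- : sqnorm (B^T *m v^T) = a * sqnorm v^T; last exact: sqnorm_ge0.
by rewrite sqnorm_trmul trmxK va -scalemxAl mxE sqnormE trmxK.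
Qed.

(** With N = B B^T, the two sides are a g^T N g and g^T N^2 g, so it suffices
    that a l <= l^2 on the spectrum of N, which is nonnegative; at l = 0 both
    sides vanish. *)
Lemma gram_lower_bound (K : realType) p n (B : 'M[K]_(p, n)) (a : K)
    (g : 'cV[K]_p) :
  (forall l, eigenvalue (B *m B^T) l -> l != 0 -> a <= l) ->
  a * sqnorm (B^T *m g) <= sqnorm (B *m (B^T *m g)).
Proof.
move=> ha; have [|l [w [el w0 e1 e2]]] := @spectral_weights _ _ (B *m B^T) g.
  by rewrite trmx_mul trmxK.
rewrite sqnorm_trmul e1 mulmxA e2 mulr_sumr; apply: ler_sum => i _.
rewrite mulrCA ler_wpM2l// expr2.
have [->|l0] := eqVneq (l i) 0; first by rewrite !mulr0.
by rewrite ler_wpM2r ?ha// (eigenvalue_gram_ge0 (el i)).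
Qed.

(** Dually to [gram_lower_bound], l^2 <= b l on the nonnegative spectrum.
    Restricting to vectors B^T g keeps everything on the p x p Gram matrix
    B B^T, so that B^T B is never diagonalised. *)
Lemma gram_upper_bound (K : realType) p n (B : 'M[K]_(p, n)) (b : K)
    (g : 'cV[K]_p) :
  (forall l, eigenvalue (B *m B^T) l -> l <= b) ->
  sqnorm (B *m (B^T *m g)) <= b * sqnorm (B^T *m g).
Proof.
move=> hb; have [|l [w [el w0 e1 e2]]] := @spectral_weights _ _ (B *m B^T) g.
  by rewrite trmx_mul trmxK.
rewrite sqnorm_trmul e1 mulmxA e2 mulr_sumr; apply: ler_sum => i _.
rewrite [leRHS]mulrCA ler_wpM2l// expr2.
by rewrite ler_wpM2r ?hb// (eigenvalue_gram_ge0 (el i)).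
Qed.

(** * The Moore-Penrose pseudoinverse *)

Lemma row_free_gram_unit (K : realType) p n (B : 'M[K]_(p, n)) :
  row_free B -> B *m B^T \in unitmx.
Proof.
move=> fB; rewrite -row_free_unit; apply/inj_row_free => v v0.
apply: (row_free_inj fB); rewrite mul0mx; apply/eqP; rewrite -trmx_eq0.
apply: contraTT isT; rewrite -sqnorm_gt0 sqnormE trmxK trmx_mul mulmxA.
by rewrite -[v *m B *m _]mulmxA v0 mul0mx mxE ltxx.
Qed.

Lemma moore_penrose_full_rank (K : realType) m k n (C : 'M[K]_(m, k))
    (F : 'M[K]_(k, n)) :
  C^T *m C \in unitmx -> F *m F^T \in unitmx ->
  moore_penrose (C *m F)
    (F^T *m invmx (F *m F^T) *m invmx (C^T *m C) *m C^T).
Proof.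
set G := invmx (F *m F^T); set H := invmx (C^T *m C) => UC UF.
have sG : G^T = G by rewrite trmx_inv trmx_mul trmxK.
have sH : H^T = H by rewrite trmx_inv trmx_mul trmxK.
set X := F^T *m G *m H *m C^T.
have AX : C *m F *m X = C *m H *m C^T.
  by rewrite /X -!mulmxA (mulmxA F) (mulmxA (F *m _)) mulmxV// mul1mx.
have XA : X *m (C *m F) = F^T *m G *m F.
  by rewrite /X -!mulmxA (mulmxA C^T) (mulmxA H) mulVmx// mul1mx.
split.
- by rewrite AX -!mulmxA (mulmxA C^T) (mulmxA H) mulVmx// mul1mx.
- rewrite XA /X -!mulmxA (mulmxA F F^T) (mulmxA (F *m _)) mulmxV//.
  by rewrite mul1mx.
- by rewrite AX !trmx_mul trmxK sH mulmxA.
- by rewrite XA !trmx_mul trmxK sG mulmxA.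
Qed.

(** Existence: in the full-rank factorisation of A the right factor has
    independent rows and the left one independent columns, so both of their
    Gram matrices are invertible. *)
Lemma moore_penrose_mpinv (K : realType) m n (A : 'M[K]_(m, n)) :
  moore_penrose A (mpinv A).
Proof.
apply: (@xgetPex _ 0 [set X | moore_penrose A X]).
have UF : row_base A *m (row_base A)^T \in unitmx.
  by apply: row_free_gram_unit; exact: row_base_free.
have UC : (col_base A)^T *m col_base A \in unitmx.
  rewrite -[X in _ *m X]trmxK; apply: row_free_gram_unit.
  by rewrite /row_free mxrank_tr; exact: col_base_full.
have := moore_penrose_full_rank UC UF; rewrite mulmx_base => AX.
by eexists; exact: AX.
Qed.

Lemma mpinv_range (K : realType) p n (B : 'M[K]_(p, n)) :
  mpinv B = B^T *m ((mpinv B)^T *m mpinv B).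
Proof.
have [_ XBX _ sXB] := moore_penrose_mpinv B.
by rewrite mulmxA -trmx_mul sXB XBX.
Qed.

Lemma mpinv_proj_range (K : realType) p n (B : 'M[K]_(p, n)) :
  mpinv B *m B = B^T *m (mpinv B)^T.
Proof. by have [_ _ _ <-] := moore_penrose_mpinv B; rewrite trmx_mul. Qed.

Lemma sqnorm_proj (K : realType) n (Q : 'M[K]_n) (v : 'cV[K]_n) :
  Q *m Q = Q -> Q^T = Q -> sqnorm v = sqnorm (Q *m v) + sqnorm (v - Q *m v).
Proof.
move=> QQ sQ.
have sv : (v - Q *m v)^T = v^T - v^T *m Q by rewrite linearB /= trmx_mul sQ.
have sQv : (Q *m v)^T = v^T *m Q by rewrite trmx_mul sQ.
have vQQv : v^T *m Q *m (Q *m v) = v^T *m Q *m v.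
  by rewrite mulmxA -(mulmxA _ Q Q) QQ.
rewrite !sqnormE sv sQv mulmxBl !mulmxBr vQQv mulmxA !mxE; ring.
Qed.

(** B^+ e = B^T g for some g, so [gram_lower_bound] bounds a |B^+ e|^2 by
    |B B^+ e|^2, and B B^+ is an orthogonal projection. *)
Lemma sqnorm_mpinv_le (K : realType) p n (B : 'M[K]_(p, n)) (a : K)
    (e : 'cV[K]_p) :
  (forall l, eigenvalue (B *m B^T) l -> l != 0 -> a <= l) ->
  a * sqnorm (mpinv B *m e) <= sqnorm e.
Proof.
move=> ha; have [BXB XBX sBX sXB] := moore_penrose_mpinv B.
rewrite {1}mpinv_range -mulmxA; apply: le_trans (gram_lower_bound _ ha) _.
rewrite [B^T *m _]mulmxA -mpinv_range mulmxA.
rewrite (@sqnorm_proj _ _ (B *m mpinv B) e) ?lerDl ?sqnorm_ge0//.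
by rewrite mulmxA BXB.
Qed.

(** B v = B (B^+ B v), and B^+ B v is in the range of B^T, where
    [gram_upper_bound] applies. *)
Lemma sqnorm_mul_le_proj (K : realType) p n (B : 'M[K]_(p, n)) (b : K)
    (v : 'cV[K]_n) :
  (forall l, eigenvalue (B *m B^T) l -> l <= b) ->
  sqnorm (B *m v) <= b * sqnorm (mpinv B *m B *m v).
Proof.
move=> hb; have [BXB _ _ _] := moore_penrose_mpinv B.
have -> : B *m v = B *m (mpinv B *m B *m v) by rewrite !mulmxA BXB.
rewrite mpinv_proj_range -!(mulmxA B^T).
exact: gram_upper_bound.
Qed.

(** The vector on the left is the sum of v - B^+ B v, orthogonal to the range
    of B^T, and of - B^+ e, which lies in it. *)
Lemma sqnorm_step (K : realType) p n (B : 'M[K]_(p, n)) (v : 'cV[K]_n)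
    (e : 'cV[K]_p) :
  sqnorm (v - mpinv B *m (B *m v + e)) =
  sqnorm v - sqnorm (mpinv B *m B *m v) + sqnorm (mpinv B *m e).
Proof.
have [BXB XBX sBX sXB] := moore_penrose_mpinv B.
set X := mpinv B in BXB XBX sBX sXB *.
have QQ : X *m B *m (X *m B) = X *m B by rewrite mulmxA XBX.
have Qw : X *m B *m (v - X *m (B *m v + e)) = - (X *m e).
  by rewrite mulmxBr !mulmxDr !mulmxA XBX opprD addrA subrr add0r.
rewrite (sqnorm_proj _ QQ sXB) Qw opprK mulmxDr opprD !mulmxA addrA subrK.
rewrite (sqnorm_proj v QQ sXB) sqnormN; ring.
Qed.

(** * Row blocks *)

Lemma sum_sqnorm_rows (K : realType) m d (tau : 'I_d -> {set 'I_m})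
    (y : 'cV[K]_m) :
  \sum_l sqnorm (rows (tau l) y) = \sum_i (multiplicity tau i)%:R * y i 0 ^+ 2.
Proof.
have sq_rows l : sqnorm (rows (tau l) y) =
    \sum_i if i \in tau l then y i 0 ^+ 2 else 0.
  rewrite -big_mkcond (big_enum_val (fun i => y i 0 ^+ 2)).
  by apply: eq_bigr => k _; rewrite mxE.
rewrite (eq_bigr _ (fun l _ => sq_rows l)) exchange_big.
apply: eq_bigr => i _ /=.
by rewrite -big_mkcond /= sumr_const mulr_natl.
Qed.

Lemma rows_mulmx (K : realType) m n p (t : {set 'I_m}) (A : 'M[K]_(m, n))
    (B : 'M[K]_(n, p)) :
  rows t (A *m B) = rows t A *m B.
Proof. by rewrite /rows mul_rowsub_mx. Qed.

(** Keeps the error in the range of A^T: a block step moves the iterate within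
    the range of the transpose of a row block. *)
Lemma rows_range (K : realType) m n (A : 'M[K]_(m, n)) (t : {set 'I_m})
    (g : 'cV[K]_#|t|) :
  exists g' : 'cV[K]_m, (rows t A)^T *m g = A^T *m g'.
Proof.
exists ((rowsub (fun i : 'I_#|t| => enum_val i) (1%:M : 'M[K]_m))^T *m g).
by rewrite mulmxA -trmx_mul mul_rowsub_mx mul1mx.
Qed.

(** * Extreme eigenvalues and the smallest nonzero singular value *)

Lemma lambda_min_nz_le (K : realType) p (M : 'M[K]_p) (a l : K) :
  (a%:E <= lambda_min_nz M)%E -> eigenvalue M l -> l != 0 -> a <= l.
Proof.
move=> h el l0; rewrite -lee_fin; apply: le_trans h _.
by apply: ereal_inf_lbound; exists l.
Qed.

Lemma lambda_max_ge (K : realType) p (M : 'M[K]_p) (b l : K) :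
  (lambda_max M <= b%:E)%E -> eigenvalue M l -> l <= b.
Proof.
move=> h el; rewrite -lee_fin; apply: le_trans h.
by apply: ereal_sup_ubound; exists l.
Qed.

Lemma eigenvalue_gramC (K : realType) m n (A : 'M[K]_(m, n)) (a : K) :
  eigenvalue (A *m A^T) a -> a != 0 -> eigenvalue (A^T *m A) a.
Proof.
move=> /eigenvalueP[v va v0] a0; apply/eigenvalueP; exists (v *m A).
  by rewrite mulmxA -[v *m A *m _]mulmxA va -scalemxAl.
apply: contra_neq v0 => vA0; apply/eqP; have := va.
rewrite mulmxA vA0 mul0mx => /esym/eqP.
by rewrite scalemx_eq0 (negPf a0).
Qed.

(** The spectrum is finite, being the root set of the characteristic
    polynomial.  This is what keeps the infimum [sigma_min_nz] away from 0. *)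
Lemma eigenvalue_lower_bound (K : realType) n (M : 'M[K]_n) :
  exists2 c : K, 0 < c & forall a, eigenvalue M a -> 0 < a -> c <= a.
Proof.
have p0 : char_poly M != 0 by rewrite monic_neq0// char_poly_monic.
exists (\big[Num.min/1]_(x <- rootsR (char_poly M) | 0 < x) x).
  exact: lt_bigmin.
move=> a; rewrite eigenvalue_root_char => ra a0.
by apply: ge_bigmin_seq => //; rewrite -(roots_on_rootsR p0).
Qed.

Lemma singular_value_sqrt (K : realType) m n (A : 'M[K]_(m, n)) (a : K) :
  eigenvalue (A *m A^T) a -> a != 0 ->
  singular_value A (Num.sqrt a) /\ Num.sqrt a != 0.
Proof.
move=> ea a0; have a_ge0 := eigenvalue_gram_ge0 ea.
split; last by rewrite sqrtr_eq0 -ltNge lt_def a0.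
by split; [exact: sqrtr_ge0|rewrite sqr_sqrtr//; exact: eigenvalue_gramC].
Qed.

(** Relates the singular values, defined through A^T A, to the Gram matrix
    A A^T used in [gram_lower_bound]: both have the same nonzero spectrum. *)
Lemma sigma_min_nz_sqr_le (K : realType) m n (A : 'M[K]_(m, n)) (a : K) :
  eigenvalue (A *m A^T) a -> a != 0 -> sigma_min_nz A ^+ 2 <= a.
Proof.
move=> ea a0; have a_ge0 := eigenvalue_gram_ge0 ea.
have sv := singular_value_sqrt ea a0.
have inf_le : sigma_min_nz A <= Num.sqrt a.
  by apply: ge_inf => //; exists 0 => s [[]].
rewrite -[leRHS](sqr_sqrtr a_ge0) ler_sqr ?nnegrE ?sqrtr_ge0//.
by apply: lb_le_inf; [exists (Num.sqrt a)|move=> s [[]]].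
Qed.

Lemma sqnorm_trmul_gt0 (K : realType) m n (A : 'M[K]_(m, n)) :
  A != 0 -> exists g : 'cV[K]_m, 0 < sqnorm (A^T *m g).
Proof.
move=> A0; have /existsP[i Ai] : [exists i, row i A != 0].
  apply: contraNT A0; rewrite negb_exists => /forallP Ai.
  apply/eqP/row_matrixP => i; rewrite row0; apply/eqP.
  by rewrite -[_ == _]negbK.
by exists (delta_mx i 0); rewrite sqnorm_gt0 -colE -tr_row trmx_eq0.
Qed.

(** For A != 0 some g^T A A^T g is positive, so A A^T has a nonzero eigenvalue
    and the infimum is over a nonempty set, bounded below by
    [eigenvalue_lower_bound]. *)
Lemma sigma_min_nz_gt0 (K : realType) m n (A : 'M[K]_(m, n)) :
  A != 0 -> 0 < sigma_min_nz A.
Proof.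
move=> A0.
have [a ea a0] : exists2 a, eigenvalue (A *m A^T) a & a != 0.
  have [g] := sqnorm_trmul_gt0 A0.
  have [|l [w [el w0 e1 _]]] := @spectral_weights _ _ (A *m A^T) g.
    by rewrite trmx_mul trmxK.
  rewrite sqnorm_trmul e1 => /lt0r_neq0 s0.
  have /existsP[k lk] : [exists k, l k != 0].
    apply: contraNT s0; rewrite negb_exists => /forallP lk.
    rewrite big1// => k _; have := lk k; rewrite negbK => /eqP->.
    by rewrite mulr0.
  by exists (l k).
have [c c0 hc] := eigenvalue_lower_bound (A^T *m A).
apply: (@lt_le_trans _ _ (Num.sqrt c)); first by rewrite sqrtr_gt0.
apply: lb_le_inf; first by exists (Num.sqrt a); exact: singular_value_sqrt.
move=> s [[s0 es] sn0]; rewrite -(ger0_norm s0) -sqrtr_sqr ler_wsqrtr// hc//.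
by rewrite exprn_even_gt0.
Qed.

Lemma sigma_min_nz_bound (K : realType) m n (A : 'M[K]_(m, n)) (g : 'cV[K]_m) :
  sigma_min_nz A ^+ 2 * sqnorm (A^T *m g) <= sqnorm (A *m (A^T *m g)).
Proof. by apply: gram_lower_bound => l; exact: sigma_min_nz_sqr_le. Qed.

(** * Random recursions driven by independent uniform choices *)

Fixpoint trajectory (X : Type) (d : nat) (step : 'I_d -> X -> X) (x0 : X)
    (c : nat -> 'I_d) (k : nat) : X :=
  if k is k'.+1 then step (c k') (trajectory step x0 c k') else x0.

Definition mean_step (K : realType) (X : Type) (d : nat)
    (step : 'I_d -> X -> X) (h : X -> K) : X -> K :=
  fun x => d%:R^-1 * \sum_l h (step l x).

Definition choices_from (Omega : Type) (d : nat) (c : nat -> Omega -> 'I_d)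
    (j : nat) (ls : seq 'I_d) : set Omega :=
  [set w | [seq c k w | k <- iota j (size ls)] = ls].

Lemma choices_from_cons (Omega : Type) d (c : nat -> Omega -> 'I_d) j l ls :
  choices_from c j (l :: ls) =
  (c j @^-1` [set l] `&` choices_from c j.+1 ls)%classic.
Proof.
apply/seteqP; split => w /=; rewrite /choices_from /=.
  by move=> [-> ->].
by move=> [-> ->].
Qed.

(** Linearity, in the form needed to unfold the averaging operator from the
    inside in [integral_trajectory]. *)
Lemma iter_mean_step_linear (K : realType) (X : Type) d
    (step : 'I_d -> X -> X) (a : K) (f : 'I_d -> X -> K) j x :
  iter j (mean_step step) (fun y => a * \sum_l f l y) x =
  a * \sum_l iter j (mean_step step) (f l) x.
Proof.
elim: j x => [//|j IH] x; rewrite iterS /mean_step.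
under eq_bigr do rewrite IH.
rewrite -mulr_sumr mulrCA; congr (_ * _); rewrite exchange_big mulr_sumr.
by apply: eq_bigr.
Qed.

Lemma measurable_choices_from (K : realType) disp
    (Omega : measurableType disp) (P : probability Omega K) d
    (c : nat -> Omega -> 'I_d) j ls :
  iid_uniform P c -> measurable (choices_from c j ls).
Proof.
move=> [mc _ _]; elim: ls j => [|l ls IH] j.
  rewrite (_ : choices_from c j [::] = setT)%classic; first exact: measurableT.
  by apply/seteqP; split.
by rewrite choices_from_cons; apply: measurableI.
Qed.

Lemma probability_choices_from (K : realType) disp
    (Omega : measurableType disp) (P : probability Omega K) d
    (c : nat -> Omega -> 'I_d) ls :
  iid_uniform P c -> P (choices_from c 0 ls) = (d%:R^-1 ^+ size ls)%:E.
Proof.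
case: ls => [|l0 ls'] [mc Pc Ic].
  rewrite (_ : choices_from c 0 [::] = setT)%classic ?probability_setT//.
  by apply/seteqP; split.
move: (l0 :: ls') => ls.
have -> : choices_from c 0 ls =
    (\bigcap_(k in [set` [fset k in iota 0 (size ls)]%fset])
      (c k @^-1` [set nth l0 ls k]))%classic.
  apply/seteqP; split => w /=.
    move=> cw k /=; rewrite !inE mem_iota => kls.
    by have := congr1 (nth l0 ^~ k) cw;
      rewrite (nth_map 0%N) ?size_iota// nth_iota.
  move=> cw; apply: (@eq_from_nth _ l0); first by rewrite size_map size_iota.
  move=> k; rewrite size_map size_iota => kls.
  rewrite (nth_map 0%N) ?size_iota// nth_iota//.
  by apply: cw; rewrite /= !inE mem_iota.
rewrite Ic; under eq_bigr do rewrite Pc.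
rewrite prodEFin big_const_seq count_predT iter_mulr_1.
by rewrite card_fseq undup_id ?iota_uniq// size_iota.
Qed.

(** The trajectory takes finitely many values: splitting on the last choice
    writes any function of it as a finite sum of indicators of choice events
    times functions of the previous iterate, so that no measurable structure
    on the state space X is involved. *)
Lemma measurable_trajectory (K : realType) disp
    (Omega : measurableType disp) (P : probability Omega K) d
    (c : nat -> Omega -> 'I_d) (X : Type) (step : 'I_d -> X -> X) (x0 : X)
    (h : X -> K) j :
  iid_uniform P c ->
  measurable_fun setT (fun w => h (trajectory step x0 (c^~ w) j)).
Proof.
move=> [mc _ _]; elim: j h => [|j IH] h /=; first exact: measurable_cst.
rewrite (_ : (fun w => _) = fun w =>
    \sum_l \1_(c j @^-1` [set l]) w *
      h (step l (trajectory step x0 (c^~ w) j))).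
  apply: measurable_sum => l; apply: measurable_realfun.measurable_funM.
    exact: measurable_realfun.measurable_indic.
  exact: (IH (h \o step l)).
apply/funext => w; rewrite (bigD1 (c j w))//= big1 => [|l lc].
  by rewrite indicE mem_set//= mul1r addr0.
by rewrite indicE memNset ?mul0r//= => cl; rewrite cl eqxx in lc.
Qed.

(** Prescribing the choices j, j + 1, ... turns the independence of past and
    future into an induction on j.  Splitting on the value l of choice j
    rewrites a function of the iterate j + 1, restricted to the event of
    prescribed future choices ls, as a sum over l of functions of the iterate
    j restricted to l :: ls; each summand carries an extra factor 1/d, and the
    average over l is one application of [mean_step].  At j = 0 only the
    probability of a prescribed initial word of choices remains. *)
Lemma integral_trajectory (K : realType) disp
    (Omega : measurableType disp) (P : probability Omega K) d
    (c : nat -> Omega -> 'I_d) (X : Type) (step : 'I_d -> X -> X) (x0 : X)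
    (h : X -> K) j ls :
  iid_uniform P c -> (forall x, 0 <= h x) ->
  (\int[P]_w
     (h (trajectory step x0 (c^~ w) j) * \1_(choices_from c j ls) w)%:E)%E =
  (iter j (mean_step step) h x0 * d%:R^-1 ^+ size ls)%:E.
Proof.
move=> hc; have mE := measurable_choices_from _ _ hc.
elim: j h ls => [|j IH] h ls h0.
  under eq_integral do rewrite /= EFinM.
  rewrite ge0_integralZl_EFin//=; last first.
    apply/measurable_realfun.measurable_EFinP.
    exact: measurable_realfun.measurable_indic.
  rewrite integral_indic// setIT.
  by rewrite [X in (_ * X)%E](probability_choices_from _ hc) EFinM.
transitivity (\int[P]_w (\sum_l (h (step l (trajectory step x0 (c^~ w) j))
    * \1_(choices_from c j (l :: ls)) w)%:E))%E.
  apply: eq_integral => w _; rewrite sumEFin; congr EFin.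
  rewrite (bigD1 (c j w))//= big1 => [|l lc].
    rewrite addr0 !indicE; congr (_ * (nat_of_bool _)%:R).
    by apply/idP/idP; rewrite choices_from_cons !inE// => -[].
  rewrite choices_from_cons indicE memNset ?mulr0// => -[/= cl].
  by rewrite cl eqxx in lc.
rewrite ge0_integral_sum//=.
- under eq_bigr => l _ do
    rewrite (IH (h \o step l) (l :: ls) (fun x => h0 _)) /=.
  rewrite sumEFin; congr EFin; rewrite -iterS iterSr.
  rewrite iter_mean_step_linear -mulr_suml exprS /=.
  by rewrite mulrCA mulrA.
- move=> l; apply/measurable_realfun.measurable_EFinP.
  apply: measurable_realfun.measurable_funM.
    exact: (@measurable_trajectory _ _ _ P _ _ _ _ _ (h \o step l)).
  exact: measurable_realfun.measurable_indic.
- by move=> l w _; rewrite lee_fin mulr_ge0// h0.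
Qed.

Lemma expectation_trajectory (K : realType) disp
    (Omega : measurableType disp) (P : probability Omega K) d
    (c : nat -> Omega -> 'I_d) (X : Type) (step : 'I_d -> X -> X) (x0 : X)
    (h : X -> K) j :
  iid_uniform P c -> (forall x, 0 <= h x) ->
  ('E_P[fun w => h (trajectory step x0 (c^~ w) j)] =
   (iter j (mean_step step) h x0)%:E)%E.
Proof.
move=> hc h0; rewrite unlock -[in RHS](mulr1 (iter _ _ _ _)).
rewrite -(integral_trajectory step x0 j [::] hc h0).
apply: eq_integral => w _; rewrite indicE mem_set ?mulr1//.
Qed.

(** * Affine contraction of the mean squared error *)

Lemma bigminn_le (I : eqType) (s : seq I) (F : I -> nat) (d : nat) (i : I) :
  i \in s -> (\big[minn/d]_(k <- s) F k <= F i)%N.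
Proof.
elim: s => [//|k s IH]; rewrite in_cons big_cons => /orP[/eqP->|/IH le_i].
  exact: geq_minl.
exact: leq_trans (geq_minr _ _) le_i.
Qed.

(** D is the fixed point of the affine map t |-> rho t + (1 - rho) D, which
    dominates one averaging step on the invariant set V; iterating gives
    rho^j h x + (1 - rho^j) D. *)
Lemma iter_mean_step_le (K : realType) (X : Type) d (step : 'I_d -> X -> X)
    (h : X -> K) (V : X -> Prop) (rho D : K) j x :
  (0 < d)%N -> 0 <= rho -> 0 <= D ->
  (forall y, V y -> forall l, V (step l y)) ->
  (forall y, V y -> mean_step step h y <= rho * h y + (1 - rho) * D) ->
  V x -> iter j (mean_step step) h x <= rho ^+ j * h x + D.
Proof.
move=> d0 rho0 D0 stepV le1 Vx.
have dK : d%:R^-1 * d%:R = 1 :> K by rewrite mulVf// pnatr_eq0 -lt0n.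
suff : iter j (mean_step step) h x <= rho ^+ j * h x + (1 - rho ^+ j) * D.
  move=> /le_trans; apply; rewrite lerD2l mulrBl mul1r lerBlDr lerDl.
  by rewrite mulr_ge0// exprn_ge0.
elim: j x Vx => [|j IH] x Vx; first by rewrite expr0 subrr mul0r addr0 mul1r.
rewrite iterS.
apply: (@le_trans _ _ (rho ^+ j * mean_step step h x + (1 - rho ^+ j) * D)).
  rewrite /mean_step.
  have -> : rho ^+ j * (d%:R^-1 * \sum_l h (step l x)) + (1 - rho ^+ j) * D =
      d%:R^-1 * \sum_l (rho ^+ j * h (step l x) + (1 - rho ^+ j) * D).
    set E := (1 - rho ^+ j) * D.
    rewrite big_split /= -mulr_sumr sumr_const card_ord mulrDr.
    by rewrite -[E *+ d]mulr_natl (mulrA _ _ E) dK mul1r mulrCA.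
  rewrite ler_wpM2l ?invr_ge0//; apply: ler_sum => l _.
  exact/IH/stepV.
apply: (@le_trans _ _
    (rho ^+ j * (rho * h x + (1 - rho) * D) + (1 - rho ^+ j) * D)).
  by rewrite lerD2r ler_wpM2l ?exprn_ge0// le1.
by rewrite exprS le_eqVlt; apply/orP; left; apply/eqP; ring.
Qed.

Definition kaczmarz_step (K : realType) (m n d : nat) (A : 'M[K]_(m, n))
    (b : 'cV[K]_m) (tau : 'I_d -> {set 'I_m}) (l : 'I_d) (x : 'cV[K]_n) :
    'cV[K]_n :=
  x + mpinv (rows (tau l) A) *m (rows (tau l) b - rows (tau l) A *m x).

Lemma block_kaczmarz_trajectory (K : realType) m n d (A : 'M[K]_(m, n))
    (b : 'cV[K]_m) (tau : 'I_d -> {set 'I_m}) (x0 : 'cV[K]_n) c k :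
  block_kaczmarz A b tau x0 c k =
  trajectory (kaczmarz_step A b tau) x0 c k.
Proof. by elim: k => //= k ->. Qed.

(** Row i is counted once for every block containing it, hence between r and R
    times. *)
Lemma row_covering_sum (K : realType) m n (A : 'M[K]_(m, n)) d
    (alpha beta : K) r R (tau : 'I_d -> {set 'I_m}) (y : 'cV[K]_m) :
  row_covering A alpha beta r R tau ->
  r%:R * sqnorm y <= \sum_l sqnorm (rows (tau l) y) <= R%:R * sqnorm y.
Proof.
move=> [_ _ _ -> ->]; rewrite sum_sqnorm_rows !mulr_sumr.
apply/andP; split; apply: ler_sum => i _; rewrite ler_wpM2r ?sqr_ge0// ler_nat.
  by apply: bigminn_le; rewrite mem_index_enum.
exact: (leq_bigmax (F := multiplicity tau)).
Qed.

Lemma row_covering_gt0 (K : realType) m n (A : 'M[K]_(m, n)) d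
    (alpha beta : K) r R (tau : 'I_d -> {set 'I_m}) :
  A != 0 -> row_covering A alpha beta r R tau -> (0 < d)%N /\ (0 < r)%N.
Proof.
move=> A0 [cov _ _ -> _].
have d0 : (0 < d)%N.
  have /existsP[i _] : [exists i : 'I_m, true].
    apply: contraNT A0; rewrite negb_exists => /forallP noi.
    by apply/eqP/matrixP => i; have := noi i.
  by have [l _] := cov i; exact: leq_ltn_trans (leq0n l) (ltn_ord l).
split=> //; apply: (big_ind (fun k => 0 < k)%N) => // [x y x0 y0|i _].
  by rewrite leq_min x0.
by have [l il] := cov i; apply/card_gt0P; exists l.
Qed.

(** Positivity of beta, and of the contraction factor
    1 - r sigma^2 / (beta d).  For a nonzero v in the range of A^T, the blocks
    satisfy r sigma^2 |v|^2 <= sum_l |B_l v|^2 <= beta sum_l |B_l^+ B_l v|^2,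
    and each of the d projections decreases the norm. *)
Lemma row_covering_ratio (K : realType) m n (A : 'M[K]_(m, n)) d
    (alpha beta : K) r R (tau : 'I_d -> {set 'I_m}) :
  A != 0 -> row_covering A alpha beta r R tau ->
  0 < beta /\ r%:R * sigma_min_nz A ^+ 2 <= beta * d%:R.
Proof.
move=> A0 hT; have [_ _ hb _ _] := hT.
have [_ r0] := row_covering_gt0 A0 hT.
have [g v0] := sqnorm_trmul_gt0 A0; set v := A^T *m g in v0.
pose S := \sum_l sqnorm (mpinv (rows (tau l) A) *m rows (tau l) A *m v).
have sumS : r%:R * (sigma_min_nz A ^+ 2 * sqnorm v) <= beta * S.
  have /andP[rAv _] := row_covering_sum (A *m v) hT.
  apply: le_trans (le_trans rAv _).
    by rewrite ler_wpM2l//; exact: sigma_min_nz_bound.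
  rewrite mulr_sumr; apply: ler_sum => l _; rewrite rows_mulmx.
  by apply: sqnorm_mul_le_proj => a; exact: lambda_max_ge.
have S0 : 0 <= S by rewrite sumr_ge0// => l _; exact: sqnorm_ge0.
have Sd : S <= d%:R * sqnorm v.
  rewrite mulr_natl -[in leRHS](card_ord d) -sumr_const.
  apply: ler_sum => l _.
  have [_ XBX _ sXB] := moore_penrose_mpinv (rows (tau l) A).
  by rewrite [leRHS](sqnorm_proj _ _ sXB) ?lerDl ?sqnorm_ge0// mulmxA XBX.
have beta0 : 0 < beta.
  have : 0 < beta * S.
    apply: lt_le_trans sumS; rewrite mulr_gt0 ?ltr0n// mulr_gt0//.
    by rewrite exprn_gt0// sigma_min_nz_gt0.
  by rewrite ltNge; apply: contraNT; rewrite -leNgt => b0; rewrite mulr_le0_ge0.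
split=> //; rewrite -(ler_pM2r v0) -(mulrA r%:R) -(mulrA beta).
rewrite (le_trans sumS)//.
by rewrite ler_wpM2l// ltW.
Qed.

(** In the mean of [sqnorm_step] over the blocks, [row_covering_sum] compares
    the block sums of |B_l v|^2 and |e_l|^2 with |A v|^2 and |e|^2. *)
Lemma mean_kaczmarz_step_le (K : realType) m n (A : 'M[K]_(m, n))
    (b e : 'cV[K]_m) d
    (alpha beta : K) r R (tau : 'I_d -> {set 'I_m}) (xs x : 'cV[K]_n) :
  A *m xs = b + e -> 0 < alpha -> 0 < beta -> 
  row_covering A alpha beta r R tau ->
  (0 < d)%N ->
  (exists g, x - xs = A^T *m g) ->
  mean_step (kaczmarz_step A b tau) (fun x => sqnorm (x - xs)) x <=
    (1 - r%:R * sigma_min_nz A ^+ 2 / (beta * d%:R)) * sqnorm (x - xs)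
    + R%:R * sqnorm e / (alpha * d%:R).
Proof.
move=> Axs alpha0 beta0 hT d0 [g xg]; set v := x - xs.
have [_ ha hb _ _] := hT.
have dr0 : 0 < d%:R :> K by rewrite ltr0n.
have bE : b = A *m xs - e by rewrite Axs addrK.
have step_le l : sqnorm (kaczmarz_step A b tau l x - xs) <= sqnorm v
    - sqnorm (rows (tau l) (A *m v)) / beta + sqnorm (rows (tau l) e) / alpha.
  have -> : kaczmarz_step A b tau l x - xs =
      v - mpinv (rows (tau l) A) *m (rows (tau l) A *m v + rows (tau l) e).
    rewrite /kaczmarz_step addrAC -[in RHS]mulmxN; congr (_ + _ *m _).
    rewrite -!rows_mulmx bE /v mulmxBr.
    by apply/colP => i; rewrite !mxE; ring.
  rewrite sqnorm_step lerD ?lerD2l ?lerN2//.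
    rewrite ler_pdivrMr// mulrC rows_mulmx.
    by apply: sqnorm_mul_le_proj => a; exact: lambda_max_ge.
  rewrite ler_pdivlMr// mulrC.
  by apply: sqnorm_mpinv_le => a; exact: lambda_min_nz_le.
have /andP[sumA _] := row_covering_sum (A *m v) hT.
have /andP[_ sume] := row_covering_sum e hT.
have sig : sigma_min_nz A ^+ 2 * sqnorm v <= sqnorm (A *m v).
  by rewrite /v xg; exact: sigma_min_nz_bound.
rewrite /mean_step -ler_pdivlMl ?invr_gt0// invrK.
apply: le_trans (ler_sum _ (fun l _ => step_le l)) _.
rewrite big_split sumrB /= -!mulr_suml sumr_const card_ord.
rewrite -[sqnorm v *+ d]mulr_natl.
have -> : d%:R * ((1 - r%:R * sigma_min_nz A ^+ 2 / (beta * d%:R)) * sqnorm v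
      + R%:R * sqnorm e / (alpha * d%:R)) =
    d%:R * sqnorm v - r%:R * (sigma_min_nz A ^+ 2 * sqnorm v) / beta
      + R%:R * sqnorm e / alpha.
  by field; rewrite !gt_eqF.
rewrite lerD ?lerD2l ?lerN2// ler_wpM2r ?invr_ge0 ?(ltW alpha0) ?(ltW beta0)//.
by apply: le_trans sumA; rewrite ler_wpM2l.
Qed.

Lemma kaczmarz_step_range (K : realType) m n (A : 'M[K]_(m, n))
    (b : 'cV[K]_m) d (tau : 'I_d -> {set 'I_m}) (xs x : 'cV[K]_n) l :
  (exists g, x - xs = A^T *m g) ->
  exists g, kaczmarz_step A b tau l x - xs = A^T *m g.
Proof.
move=> [g xg]; rewrite /kaczmarz_step addrAC xg mpinv_range -mulmxA.
set z := _ *m (_ - _); have [g' ->] := rows_range A z.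
by exists (g + g'); rewrite mulmxDr.
Qed.

Theorem theorem1p4 (K : realType) (m n : nat)
    (A : 'M[K]_(m, n)) (hA : A != 0) (b : 'cV[K]_m)
    (xe : 'cV[K]_n) (e : 'cV[K]_m) (he : e = A *m xe - b)
    (d : nat) (alpha beta : K) (r R : nat) (tau : 'I_d -> {set 'I_m})
    (hT : row_covering A alpha beta r R tau) (halpha : 0 < alpha)
    (disp : measure_display) (Omega : measurableType disp)
    (P : probability Omega K) (c : nat -> Omega -> 'I_d)
    (hc : iid_uniform P c)
    (x0 xs : 'cV[K]_n)
    (hxs : xs = (1%:M - mpinv A *m A) *m x0 + mpinv A *m (b + e)) :
  xs = (1%:M - mpinv A *m A) *m x0 + mpinv A *m A *m xe /\
  forall j : nat,
    ('E_P[fun w =>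
           (norm2 (block_kaczmarz A b tau x0 (fun k => c k w) j - xs) ^+ 2)%R]
     <= ((1 - r%:R * sigma_min_nz A ^+ 2 / (beta * d%:R)) ^+ j
           * norm2 (x0 - xs) ^+ 2
         + beta * R%:R / (alpha * r%:R * sigma_min_nz A ^+ 2)
           * norm2 e ^+ 2)%:E)%E.
Proof.
(* xs solves the consistent system with right-hand side b + e = A xe. *)
have be : b + e = A *m xe by rewrite he addrC subrK.
have [AXA _ _ _] := moore_penrose_mpinv A.
have xsE : xs = (1%:M - mpinv A *m A) *m x0 + mpinv A *m A *m xe.
  by rewrite hxs be mulmxA.
split=> // j.
have Axs : A *m xs = b + e.
  rewrite xsE be mulmxDr !mulmxA mulmxBr mulmx1 !mulmxA AXA.
  by rewrite subrr mul0mx add0r.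
have [d0 r0] := row_covering_gt0 hA hT.
have [beta0 ratio] := row_covering_ratio hA hT.
have sig0 := sigma_min_nz_gt0 hA.
have dK : 0 < d%:R :> K by rewrite ltr0n.
have rK : 0 < r%:R :> K by rewrite ltr0n.
(* x0 - xs = A^+ A (x0 - xe). *)
have range0 : exists g, x0 - xs = A^T *m g.
  exists ((mpinv A)^T *m (x0 - xe)).
  rewrite mulmxA -mpinv_proj_range xsE mulmxBl mul1mx mulmxBr.
  by rewrite opprD opprB addrA addrCA subrr addr0.
under [X in ('E_P[X] <= _)%E]eq_fun do
  rewrite block_kaczmarz_trajectory norm2_sqr.
rewrite (expectation_trajectory _ _ (h := fun x => sqnorm (x - xs)) _ hc);
  last by move=> x; exact: sqnorm_ge0.
rewrite lee_fin !norm2_sqr.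
apply: (@iter_mean_step_le _ _ _ _ _
  (fun x => exists g, x - xs = A^T *m g)) => //.
- by rewrite subr_ge0 ler_pdivrMr ?mul1r// mulr_gt0.
- by rewrite mulr_ge0 ?sqnorm_ge0// divr_ge0 ?mulr_ge0 ?sqr_ge0// ltW.
- by move=> y yr l; exact: kaczmarz_step_range.
move=> y yr; apply: le_trans (mean_kaczmarz_step_le Axs _ _ hT _ yr) _ => //.
rewrite lerD2l le_eqVlt; apply/orP; left; apply/eqP; field.
by rewrite !gt_eqF.
Qed.
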